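(* Let $(B,\underline{\circ},\langle\cdot,\cdot\rangle')$ be a Frobenius-like Poisson algebra with Lie bracket $[\cdot,\cdot]_B$ and Levi-Civita product $\underline{\ast}$. Suppose there are $\mu,\lambda,\beta\in\mathbb{R}$, $a_0,b_0\in B$, a linear map $u:B\to B$ with $u([x,y]_B)=x\underline{\ast}u(y)-y\underline{\ast}u(x)$ for all $x,y$, a derivation $D$ of the Lie algebra $B$, and a linear map $v:B\to B$ with $v(x\underline{\circ}y)=v(x)\underline{\circ}y$ for all $x,y$, such that $\lambda\mu=0$, $(D-u)^\ast=-(D-u)$, $v^\ast=v$, and for all $x,y\in B$: $$[D,u]=u^2-\mu u-R_{b_0},$$ $$x\underline{\ast}u(y)-u(x\underline{\ast}y)=D(x)\underline{\ast}y+x\underline{\ast}D(y)-D(x\underline{\ast}y),$$ $$v^2=\lambda v+r_{a_0},$$ $$(u-u^\ast)(v-\lambda\,\mathrm{id}_B)=\widetilde{\mathrm{ad}}_{a_0}+D^\ast v,\qquad v([x,y]_B)=[v(x),y]_B-D(y)\underline{\circ}x,$$ $$-\mu v+vD+D^\ast v=-r_{b_0},\qquad D(x\underline{\circ}y)=D(x)\underline{\circ}y+x\underline{\circ}D(y),$$ $$-\mu a_0+v(b_0)=\lambda b_0-D^\ast(a_0),\qquad [D,v]=0,$$ $$(u-u^\ast-2D^\ast)(a_0)=-\lambda b_0,\qquad \mathrm{ad}_{a_0}=(2v-\lambda\,\mathrm{id}_B)D,$$ $$(u-u^\ast)(x\underline{\circ}y)=\mathrm{ad}_y^\ast(v(x))+\mathrm{ad}_x^\ast(v(y)),$$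 $$-\mu\beta+\langle a_0,b_0\rangle'=0,\qquad D(a_0)=0.$$ Let $\mathfrak{g}=\mathbb{R}a\oplus B\oplus\mathbb{R}d$ be equipped with: (1) the scalar product $\langle\cdot,\cdot\rangle$ extending $\langle\cdot,\cdot\rangle'$ for which $\mathbb{R}a\oplus\mathbb{R}d$ is a hyperbolic plane ($\langle a,a\rangle=\langle d,d\rangle=0$, $\langle a,d\rangle=1$) orthogonal to $B$; (2) the skew-symmetric bracket given, for $x,y\in B$, by $[d,a]=\mu a$, $[d,x]=-\langle b_0,x\rangle'a+D(x)$, $[x,y]=\langle(u-u^\ast)(x),y\rangle'a+[x,y]_B$, $[a,x]=0$; (3) the commutative product $\circ$ given, for $x,y\in B$, by $a\circ a=a\circ x=0$, $x\circ y=\langle v(x),y\rangle'a+x\underline{\circ}y$, $a\circ d=\lambda a$, $d\circ d=\beta a+a_0+\lambda d$, $d\circ x=\langle a_0,x\rangle'a+v(x)$. Then $(\mathfrak{g},\circ,\langle\cdot,\cdot\rangle)$ is a Frobenius-like Poisson algebra.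
   Context: All Lie algebras and vector spaces are real and finite-dimensional. A scalar product is a non-degenerate symmetric bilinear form. For a Lie algebra $\mathfrak{g}$ with scalar product $\langle\cdot,\cdot\rangle$, the Levi-Civita product $\ast$ is the unique bilinear product with $[x,y]=x\ast y-y\ast x$ and $\langle x\ast y,z\rangle+\langle y,x\ast z\rangle=0$. The scalar product is flat if $\ast$ is left-symmetric: $(x\ast y)\ast z-x\ast(y\ast z)=(y\ast x)\ast z-y\ast(x\ast z)$. A Frobenius-like Poisson algebra is a triple $(\mathfrak{g},\circ,\langle\cdot,\cdot\rangle)$ where $\mathfrak{g}$ is a Lie algebra, $\circ$ is an associative commutative bilinear product (no unit required) with $[x,y\circ z]=[x,y]\circ z+[x,z]\circ y$ for all $x,y,z$, and $\langle\cdot,\cdot\rangle$ is a flat scalar product with $\langle x\circ y,z\rangle=\langle x,y\circ z\rangle$ for all $x,y,z$. Notation on $B$: for a linear map $s:B\to B$, $s^\ast$ is its adjoint with respect to $\langle\cdot,\cdot\rangle'$; $R_s(x)=x\underline{\ast}s$; $r_s(x)=x\underline{\circ}s$; $\mathrm{ad}_s(x)=[s,x]_B$, with adjoint $\mathrm{ad}_s^\ast$; $\widetilde{\mathrm{ad}}_s(x)=\mathrm{ad}_x^\ast(s)$. Brackets of linear maps are commutators. *)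

(* Defs.v *)
From HB Require Import structures.
From mathcomp Require Import all_boot all_order all_algebra.
From mathcomp Require Import boolp classical_sets reals.
From mathcomp Require Import ring lra.

Set Implicit Arguments.
Unset Strict Implicit.
Unset Printing Implicit Defensive.
Import Order.TTheory GRing.Theory Num.Theory.
Local Open Scope ring_scope.

Section Structures.
Context {R : realType} {V : vectType R}.
Implicit Types (br op p : V -> V -> V) (form : V -> V -> R) (f g : V -> V).

Definition bilinear_op op : Prop :=
  (forall x, linear (op x)) /\ (forall y, linear (op^~ y)).

Definition bilinear_form form : Prop :=
  (forall x, scalar (form x)) /\ (forall y, scalar (form^~ y)).

Record lie_bracket br : Prop := LieBracket {
  lie_bilinear : bilinear_op br;
  lie_alternating : forall x, br x x = 0;
  lie_jacobi : forall x y z,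
    br x (br y z) + br y (br z x) + br z (br x y) = 0 }.

(* No positivity is required: the signature is arbitrary. *)
Record scalar_product form : Prop := ScalarProduct {
  sp_bilinear : bilinear_form form;
  sp_sym : forall x y, form x y = form y x;
  sp_nondegenerate : forall x, (forall y, form x y = 0) -> x = 0 }.

Record is_levi_civita br form p : Prop := IsLeviCivita {
  lc_bilinear : bilinear_op p;
  lc_torsion_free : forall x y, br x y = p x y - p y x;
  lc_metric : forall x y z, form (p x y) z + form y (p x z) = 0 }.

(* Chosen among the products satisfying [is_levi_civita]; existence and
   uniqueness are [levi_civitaP] and [levi_civita_unique] below. *)
Definition levi_civita br form : V -> V -> V :=
  xget (fun _ _ => 0) [set p | is_levi_civita br form p]%classic.

Definition left_symmetric p : Prop := forall x y z,
  p (p x y) z - p x (p y z) = p (p y x) z - p y (p x z).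

Definition flat br form : Prop := left_symmetric (levi_civita br form).

Record frobenius_like_poisson br op form : Prop := FrobeniusLikePoisson {
  flp_lie : lie_bracket br;
  flp_bilinear : bilinear_op op;
  flp_assoc : associative op;
  flp_comm : commutative op;
  flp_leibniz : forall x y z, br x (op y z) = op (br x y) z + op (br x z) y;
  flp_scalar_product : scalar_product form;
  flp_flat : flat br form;
  flp_invariant : forall x y z, form (op x y) z = form x (op y z) }.

Definition derivation op f : Prop :=
  forall x y, f (op x y) = op (f x) y + op x (f y).

Definition commutator f g : V -> V := fun x => f (g x) - g (f x).

(* See [adjointP] and [adjoint_unique]. *)
Definition adjoint form f : V -> V :=
  fun y => xget 0 [set z | forall x, form (f x) y = form x z]%classic.

(* The maps written R_s, r_s (with [op] the Levi-Civita, resp. the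
   commutative product), ad_s and \widetilde{ad}_s. *)
Definition rmul op (s : V) : V -> V := fun x => op x s.
Definition ad br (s : V) : V -> V := br s.
Definition ad_tilde br form (s : V) : V -> V :=
  fun x => adjoint form (ad br x) s.

End Structures.

Section StructuresTheory.
Context {R : realType} {V : vectType R}.
Implicit Types (br op p : V -> V -> V) (form : V -> V -> R) (f g : V -> V).

Lemma form_inj form : scalar_product form ->
  forall x y, (forall z, form x z = form y z) -> x = y.
Proof.
move=> hf x y exy; apply/eqP; rewrite -subr_eq0; apply/eqP.
apply: (sp_nondegenerate hf) => z; move: (sp_bilinear hf).
case=> _ /(_ z (-1) y x).
by rewrite /= exy mulN1r scaleN1r [- y + x]addrC addNr.
Qed.

Lemma riesz form : scalar_product form ->
  forall h : V -> R, scalar h -> exists z, forall x, form z x = h x.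
Proof.
move=> hf h hh.
pose e := vbasis {:V}; pose n := \dim {:V}.
have ebas : basis_of fullv e by apply: vbasisP.
pose Phi0 (x : V) : 'rV[R]_n := \row_i form x (e`_i).
have Phi0lin : linear Phi0.
  move=> a x y; apply/rowP => i; rewrite !mxE.
  exact: (sp_bilinear hf).2.
pose PhiL : {linear V -> 'rV[R]_n} :=
  HB.pack Phi0 (GRing.isLinear.Build R V 'rV[R]_n *:%R Phi0 Phi0lin).
pose Phi := linfun PhiL.
have det k k' : scalar k -> scalar k' ->
    (forall i : 'I_n, k (e`_i) = k' (e`_i)) -> k =1 k'.
  move=> hk hk' kk x.
  have s0 (q : V -> R) : scalar q -> q 0 = 0.
    by move=> hq; have := hq (-1) 0 0; rewrite /= scaler0 addr0 mulN1r addNr.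
  have sS (q : V -> R) : scalar q -> forall c : 'I_n -> R,
      q (\sum_i c i *: e`_i) = \sum_i c i * q e`_i.
    move=> hq c; elim/big_rec2: _ => [|i y1 y2 _ IH]; first exact: s0.
    by rewrite hq IH.
  rewrite (coord_basis ebas (memvf x)) (sS k) // (sS k') //.
  by apply: eq_bigr => i _; rewrite kk.
have kerP : lker Phi == 0%VS.
  apply/lker0P => x y; rewrite !lfunE => /rowP exy.
  apply: (form_inj hf); apply: det; try exact: (sp_bilinear hf).1.
  by move=> i; have := exy i; rewrite !mxE.
have im : limg Phi = fullv.
  apply/eqP; rewrite eqEdim subvf /= limg_dim_eq ?(eqP kerP) ?capv0 //.
  by rewrite -/n dimvf /dim /= mul1n.
have : (\row_i h (e`_i) : 'rV[R]_n) \in limg Phi by rewrite im memvf.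
case/memv_imgP => z _ ez; exists z; apply: det => //.
  exact: (sp_bilinear hf).1.
by move=> i; move/rowP/(_ i): ez; rewrite lfunE !mxE.
Qed.

Lemma adjointP form f : scalar_product form -> linear f ->
  forall x y, form (f x) y = form x (adjoint form f y).
Proof.
move=> hf lf x y; rewrite /adjoint; case: xgetP => [z _ /(_ x)//|/= nex].
have [|z hz] := @riesz form hf (fun x => form (f x) y).
  by move=> a s t; rewrite lf; apply: (sp_bilinear hf).2.
by case: (nex z) => t; rewrite -hz (sp_sym hf).
Qed.

Lemma adjoint_unique form f g : scalar_product form -> linear f ->
  (forall x y, form (f x) y = form x (g y)) -> g =1 adjoint form f.
Proof.
move=> hf lf hg y; apply: (form_inj hf) => x.
by rewrite !(sp_sym hf _ x) -hg; apply: adjointP.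
Qed.

Lemma levi_civita_exists br form : lie_bracket br -> scalar_product form ->
  exists p, is_levi_civita br form p.
Proof.
move=> [[br2 br1] bralt _] hf; have [[f2 f1] fsym _] := hf.
have fD1 x y z : form (x + y) z = form x z + form y z.
  by rewrite -[x]scale1r f1 mul1r scale1r.
have fD2 x y z : form z (x + y) = form z x + form z y.
  by rewrite !(fsym z) fD1.
have f01 z : form 0 z = 0 by apply: (addrI (form 0 z)); rewrite -fD1 !addr0.
have fN1 x z : form (- x) z = - form x z.
  by apply: (addrI (form x z)); rewrite -fD1 !subrr f01.
have fZ1 a x z : form (a *: x) z = a * form x z.
  by rewrite -[_ *: _]addr0 f1 f01 addr0.
have fZ2 a x z : form z (a *: x) = a * form z x by rewrite !(fsym z) fZ1.
have bD1 x y z : br (x + y) z = br x z + br y z.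
  by rewrite -[x]scale1r br1 !scale1r.
have bD2 x y z : br z (x + y) = br z x + br z y.
  by rewrite -[x]scale1r br2 !scale1r.
have b01 z : br 0 z = 0 by apply: (addrI (br 0 z)); rewrite -bD1 !addr0.
have b02 z : br z 0 = 0 by apply: (addrI (br z 0)); rewrite -bD2 !addr0.
have bZ1 a x z : br (a *: x) z = a *: br x z.
  by rewrite -[_ *: _]addr0 br1 b01 addr0.
have bZ2 a x z : br z (a *: x) = a *: br z x.
  by rewrite -[_ *: _]addr0 br2 b02 addr0.
have bC x y : br x y = - br y x.
  apply/eqP; rewrite -addr_eq0; apply/eqP.
  by have := bralt (x + y); rewrite bD1 !bD2 !bralt add0r addr0.
(* Koszul formula *)
pose K x y w := 2^-1 * (form (br x y) w - form (br y w) x + form (br w x) y).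
have Klin x y : scalar (K x y).
  by move=> a s t; rewrite /K bD1 bD2 bZ1 bZ2 !fD1 !fD2 !fZ1 !fZ2; ring.
pose p x y := sval (cid (riesz hf (Klin x y))).
have pE x y w : form (p x y) w = K x y w by rewrite /p; case: cid.
exists p; split.
- split=> [x a s t|y a s t] /=; apply: (form_inj hf) => w;
    rewrite fD1 fZ1 !pE /K !(bD1, bD2, bZ1, bZ2) !(fD1, fD2, fZ1, fZ2); ring.
- move=> x y; apply: (form_inj hf) => w.
  rewrite fD1 fN1 !pE /K (bC y x) (bC w x) (bC w y) !fN1; lra.
- move=> x y z; rewrite (fsym y) !pE /K (bC z x) (bC z y) (bC y x) !fN1; ring.
Qed.

Lemma levi_civitaP br form : lie_bracket br -> scalar_product form ->
  is_levi_civita br form (levi_civita br form).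
Proof.
by move=> hb hf; rewrite /levi_civita; apply: xgetPex; apply: levi_civita_exists.
Qed.

Lemma levi_civita_unique br form p : lie_bracket br -> scalar_product form ->
  is_levi_civita br form p -> p = levi_civita br form.
Proof.
move=> hb hf hp; have hq := levi_civitaP hb hf.
set q := levi_civita _ _ in hq *.
case: hp hq => _ pt pm [_ qt qm]; have [[f2 f1] fsym _] := hf.
have fB x y z : form (x - y) z = form x z - form y z.
  have e := f1 z (-1) y x; rewrite /= in e.
  by rewrite addrC -scaleN1r e mulN1r addrC.
pose d x y w := form (p x y) w - form (q x y) w.
have d1 x y w : d x y w = d y x w.
  have := congr1 (form^~ w) (etrans (esym (pt x y)) (qt x y)).
  by rewrite /= !fB /d; lra.
have d2 x y w : d x y w = - d x w y.
  by rewrite /d; have := pm x y w; have := qm x y w; rewrite !(fsym y); lra.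
apply/funext => x; apply/funext => y; apply: (form_inj hf) => w.
have := d1 x y w; have := d1 y w x; have := d1 w x y.
have := d2 x y w; have := d2 y w x; have := d2 w x y.
by rewrite /d; lra.
Qed.

End StructuresTheory.

Section DoubleExtension.
Context {R : realType} {B : vectType R}.

(* An element (s, x, t) stands for s a + x + t d. *)
Definition dext : vectType R := (R^o * B * R^o)%type.

Variables (br op : B -> B -> B) (form : B -> B -> R).
Variables (mu lambda beta : R) (a0 b0 : B) (u D v : B -> B).

Definition dext_a : dext := (1, 0, 0).
Definition dext_d : dext := (0, 0, 1).
Definition dext_B (x : B) : dext := (0, x, 0).

Definition dext_form (p q : dext) : R :=
  let: (s, x, t) := p in let: (s', x', t') := q in
  form x x' + s * t' + t * s'.

Definition dext_bracket (p q : dext) : dext :=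
  let: (s, x, t) := p in let: (s', x', t') := q in
  (mu * (t * s' - s * t') - t * form b0 x' + t' * form b0 x
     + form (u x - adjoint form u x) x',
   t *: D x' - t' *: D x + br x x',
   0).

Definition dext_prod (p q : dext) : dext :=
  let: (s, x, t) := p in let: (s', x', t') := q in
  (lambda * (s * t' + t * s') + beta * (t * t')
     + t * form a0 x' + t' * form a0 x + form (v x) x',
   (t * t') *: a0 + t *: v x' + t' *: v x + op x x',
   lambda * (t * t')).

End DoubleExtension.

Arguments dext {R} B.

Section DoubleExtensionTables.
Context {R : realType} {B : vectType R}.
Variables (br op : B -> B -> B) (form : B -> B -> R).
Variables (mu lambda beta : R) (a0 b0 : B) (u D v : {linear B -> B}).
Hypotheses (hbr : lie_bracket br) (hop : bilinear_op op).
Hypothesis hform : scalar_product form.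

Local Notation a := (@dext_a R B).
Local Notation d := (@dext_d R B).
Local Notation "[ p , q ]" := (dext_bracket br form mu b0 u D p q).
Local Notation "p ** q" := (dext_prod op form lambda beta a0 v p q)
  (at level 40).

Let dextE := (scaler0, scale0r, scale1r, mulr0, mul0r, mulr1, mul1r, addr0,
  add0r, subr0, sub0r, oppr0).

Let lin0 (f : B -> B) : linear f -> f 0 = 0.
Proof.
by move=> lf; have := lf (-1) 0 0; rewrite /= scaler0 addr0 scaleN1r addNr.
Qed.

Let form0 x : form x 0 = 0.
Proof.
have := (sp_bilinear hform).1 x (-1) 0 0.
by rewrite /= scaler0 addr0 mulN1r addNr.
Qed.

Let form0l x : form 0 x = 0. Proof. by rewrite (sp_sym hform). Qed.

Let br0 x : br x 0 = 0. Proof. exact/lin0/(lie_bilinear hbr).1. Qed.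
Let br0l x : br 0 x = 0. Proof. exact: lin0 ((lie_bilinear hbr).2 x). Qed.
Let op0 x : op x 0 = 0. Proof. exact/lin0/hop.1. Qed.
Let op0l x : op 0 x = 0. Proof. exact: lin0 (hop.2 x). Qed.

Let adj0 f : linear f -> adjoint form f 0 = 0.
Proof.
move=> lf; apply: (form_inj hform) => z.
by rewrite (sp_sym hform) -adjointP // form0 form0l.
Qed.

Let zeroE := (linear0, form0, form0l, br0, br0l, op0, op0l).

Let adju0 : adjoint form u 0 = 0. Proof. exact/adj0/linearP. Qed.

Lemma dext_decomp (s t : R) (x : B) :
  (s, x, t) = s *: a + dext_B x + t *: d :> dext B.
Proof.
by congr (_, _, _); rewrite /= ?dextE //; rewrite /GRing.scale /= ?dextE.
Qed.

Lemma dext_formE x y :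
  [/\ dext_form form a a = 0, dext_form form d d = 0,
      dext_form form a d = 1, dext_form form d a = 1
    & [/\ dext_form form (dext_B x) (dext_B y) = form x y,
          dext_form form a (dext_B x) = 0, dext_form form (dext_B x) a = 0,
          dext_form form d (dext_B x) = 0 & dext_form form (dext_B x) d = 0]].
Proof. by split; [..|split]; rewrite /= ?zeroE ?dextE. Qed.

Lemma dext_bracketE x y :
  [/\ [d, a] = mu *: a, [d, dext_B x] = - form b0 x *: a + dext_B (D x),
      [dext_B x, dext_B y] =
        form (u x - adjoint form u x) y *: a + dext_B (br x y)
    & [a, dext_B x] = 0].
Proof.
split; rewrite /dext_bracket /= ?zeroE ?adju0 ?dextE ?zeroE; congr (_, _, _);
  by rewrite /= ?dextE //; rewrite /GRing.scale /= ?dextE.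
Qed.

Lemma dext_prodE x y :
  [/\ a ** a = 0, a ** dext_B x = 0,
      dext_B x ** dext_B y = form (v x) y *: a + dext_B (op x y),
      a ** d = lambda *: a
    & d ** d = beta *: a + dext_B a0 + lambda *: d /\
      d ** dext_B x = form a0 x *: a + dext_B (v x)].
Proof.
split; [..|split]; rewrite /dext_prod /= ?zeroE ?dextE; congr (_, _, _);
  by rewrite /= ?zeroE ?dextE //; rewrite /GRing.scale /= ?dextE.
Qed.

End DoubleExtensionTables.

(* Main.v *)
Require Import Defs.
From mathcomp Require Import all_boot all_order all_algebra.
From mathcomp Require Import reals.
From mathcomp Require Import ring lra.
Import GRing.Theory.
Local Open Scope ring_scope.

(** The Levi-Civita product of the double extension can be written down
    explicitly ([dext_lc]); it is recognised by uniqueness, so flatness is the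
    left symmetry of an explicit product.  Each axiom is an identity between
    triples (s, x, t): the B-component is tested against an arbitrary vector
    through the nondegenerate form, so that every equation becomes an equation
    in R, which is a combination of the hypotheses (in weak form, with adjoints
    moved across the form) with monomials in the coordinates s, t as
    coefficients. *)

(** * Expansion rules for bilinear and linear maps *)

(** The rules form one tuple so that a single multirule can expand all sums and scalars. The
    codomain is separate from [U] in order to cover both products on [B] and scalar-valued forms. *)
Lemma bilinearE {R : realType} {U V : lmodType R} (f : U -> U -> V) :
  (forall x, linear (f x)) -> (forall y, linear (f^~ y)) ->
  (forall x y z, f (x + y) z = f x z + f y z)
  * (forall x y z, f z (x + y) = f z x + f z y)
  * (forall x z, f (- x) z = - f x z)
  * (forall x z, f z (- x) = - f z x)
  * (forall c x z, f (c *: x) z = c *: f x z)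
  * (forall c x z, f z (c *: x) = c *: f z x)
  * (forall z, f 0 z = 0) * (forall z, f z 0 = 0).
Proof.
move=> f2 f1.
have D1 x y z : f (x + y) z = f x z + f y z.
  by rewrite -[x]scale1r f1 !scale1r.
have D2 x y z : f z (x + y) = f z x + f z y.
  by rewrite -[x]scale1r f2 !scale1r.
have O1 z : f 0 z = 0 by apply: (addrI (f 0 z)); rewrite -D1 !addr0.
have O2 z : f z 0 = 0 by apply: (addrI (f z 0)); rewrite -D2 !addr0.
have Z1 c x z : f (c *: x) z = c *: f x z.
  by rewrite -[_ *: x]addr0 f1 O1 addr0.
have Z2 c x z : f z (c *: x) = c *: f z x.
  by rewrite -[_ *: x]addr0 f2 O2 addr0.
have N1 x z : f (- x) z = - f x z by rewrite -scaleN1r Z1 scaleN1r.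
have N2 x z : f z (- x) = - f z x by rewrite -scaleN1r Z2 scaleN1r.
by [].
Qed.

Lemma bilinear_formE {R : realType} {V : vectType R} {form : V -> V -> R} :
  bilinear_form form ->
  (forall x y z, form (x + y) z = form x z + form y z)
  * (forall x y z, form z (x + y) = form z x + form z y)
  * (forall x z, form (- x) z = - form x z)
  * (forall x z, form z (- x) = - form z x)
  * (forall c x z, form (c *: x) z = c * form x z)
  * (forall c x z, form z (c *: x) = c * form z x)
  * (forall z, form 0 z = 0) * (forall z, form z 0 = 0).
(* In [R^o], the field as a module over itself, scaling is multiplication. *)
Proof. by case=> f2 f1; apply: (@bilinearE R V R^o). Qed.

Lemma linear_mapE {R : realType} {V : vectType R} (f : {linear V -> V}) :
  (forall x y, f (x + y) = f x + f y) * (forall x, f (- x) = - f x)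
  * (forall c x, f (c *: x) = c *: f x) * (f 0 = 0).
Proof.
by do ![split] => *; rewrite (linearD, linearN, linearZ, linear0).
Qed.

(** * Coordinates and scalar product of the double extension *)

Section DoubleExtension.
Context {R : realType} {B : vectType R}.
Implicit Types (x y z : B) (s t : R).

Lemma dextD s x t s' x' t' :
  (s, x, t) + (s', x', t') = (s + s', x + x', t + t') :> dext B.
Proof. by []. Qed.

Lemma dextN s x t : - (s, x, t) = (- s, - x, - t) :> dext B.
Proof. by []. Qed.

Lemma dextZ (c : R) s x t : c *: ((s, x, t) : dext B) = (c * s, c *: x, c * t).
Proof. by []. Qed.

Context {br op ast : B -> B -> B} {form : B -> B -> R}.
Context {mu lambda beta : R} {a0 b0 : B} {u D v : {linear B -> B}}.

Local Notation gbr := (dext_bracket br form mu b0 u D).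
Local Notation gop := (dext_prod op form lambda beta a0 v).
Local Notation gform := (dext_form form).

(* By the Koszul formula: d * a = mu a, d * d = b0 - mu d,
   d * x = - <b0, x> a + (D - u)(x), x * d = - u(x) and
   x * y = <u(x), y> a + ast x y; the left factor a acts by 0. *)
Definition dext_lc (p q : dext B) : dext B :=
  let: (s, x, t) := p in let: (s', x', t') := q in
  (mu * (t * s') - t * form b0 x' + form (u x) x',
   t *: (D x' - u x') - t' *: u x + ast x x' + (t * t') *: b0,
   - (mu * (t * t'))).

Hypothesis hform : scalar_product form.

Let formE := bilinear_formE (sp_bilinear hform).
Let formC := sp_sym hform.

Lemma skew_partE x y :
  form (u x - adjoint form u x) y = form (u x) y - form x (u y).
Proof.
by rewrite !formE (formC (adjoint _ _ _)) -adjointP ?(formC (u y))//;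
  apply: linearP.
Qed.

Let linE := (linear_mapE u, linear_mapE D, linear_mapE v).

Lemma dext_eq (s t s' t' : R) x x' :
  s = s' -> (forall z, form x z = form x' z) -> t = t' ->
  (s, x, t) = (s', x', t') :> dext B.
Proof. by move=> -> /(form_inj hform) -> ->. Qed.

Lemma dext_scalar_product : scalar_product gform.
Proof.
split.
- split=> [[[s x] t] c [[s1 x1] t1] [[s2 x2] t2]|
           [[s x] t] c [[s1 x1] t1] [[s2 x2] t2]];
    rewrite ?dextZ ?dextN ?dextD /= !formE; ring.
- by move=> [[s x] t] [[s1 x1] t1] /=; rewrite formC; ring.
(* Pairing with [d], with [B] and with [a] isolates the coordinates [s], [x] and [t]
   respectively. *)
- move=> [[s x] t] h; apply: dext_eq => [|z|].
  + by have := h (0, 0, 1); rewrite /= !formE; lra.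
  + by have := h (0, z, 0); rewrite /= !formE; lra.
  + by have := h (1, 0, 0); rewrite /= !formE; lra.
Qed.

(** * Jacobi identity and flatness *)

Section Bracket.
Hypotheses (hbr : lie_bracket br) (hast : is_levi_civita br form ast).

Let brE := @bilinearE _ _ _ br (lie_bilinear hbr).1 (lie_bilinear hbr).2.
Let astE := @bilinearE _ _ _ ast (lc_bilinear hast).1 (lc_bilinear hast).2.
Let ast_br x y : br x y = ast x y - ast y x := lc_torsion_free hast x y.
Let ast_skew x y z : form (ast x y) z = - form (ast x z) y.
Proof. by have := lc_metric hast x y z; rewrite (formC y); lra. Qed.

Hypothesis Du_skew :
  forall x y, form (D x - u x) y = - form x (D y - u y).

(** Left multiplication by [d] acts on [B] through [D - u], so metric compatibility reduces to
    [Du_skew] and to the skewness of left multiplications for [ast]. *)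
Lemma dext_levi_civita : is_levi_civita gbr gform dext_lc.
Proof.
split.
- split=> [[[s x] t] c [[s1 x1] t1] [[s2 x2] t2]|
           [[s x] t] c [[s1 x1] t1] [[s2 x2] t2]];
    rewrite /= ?dextZ ?dextN ?dextD; apply: dext_eq => [|z|];
    rewrite ?(linE, formE, astE) /GRing.scale /=; ring.
- move=> [[s x] t] [[s1 x1] t1].
  rewrite /= ?dextZ ?dextN ?dextD; apply: dext_eq => [|z|].
  + rewrite skew_partE (formC x); ring.
  + by rewrite ast_br ?(linE, formE, astE); ring.
  + ring.
- move=> [[s x] t] [[s1 x1] t1] [[s2 x2] t2] /=.
  have h1 := congr1 ( *%R t) (Du_skew x1 x2).
  have h2 := ast_skew x x1 x2.
  move: h1; rewrite ?(linE, formE, astE).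
  rewrite (formC x1 (ast _ _)) (formC x1 b0) (formC x1 (u x)).
  lra.
Qed.

Hypotheses (ast_ls : left_symmetric ast) (hD : derivation br D).
Hypothesis hu : forall x y, u (br x y) = ast x (u y) - ast y (u x).
Hypothesis hDu :
  forall x, commutator D u x = u (u x) - mu *: u x - rmul ast b0 x.

Let brC x y : br x y = - br y x.
Proof. by rewrite !ast_br opprB. Qed.

(** Weak form of [hDu]: by [ast_skew] the term in [b0] pairs with [ast x y], which antisymmetrises
    to the bracket. *)
Let Du x y : form (D (u x)) y =
  form (u (D x)) y + form (u (u x)) y - mu * form (u x) y + form (ast x y) b0.
Proof.
have := congr1 (form^~ y) (hDu x).
by rewrite /commutator /rmul !formE [form (ast x b0) y]ast_skew; lra.
Qed.

(** This is the a-component of the Jacobi identity on [B]. By [hu] and [ast_skew] every term becomes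
    a pairing of a value of [u] with a value of [ast], and these cancel in pairs. *)
Let skew_cocycle x y z :
  form (u x) (br y z) - form x (u (br y z))
  + (form (u y) (br z x) - form y (u (br z x)))
  + (form (u z) (br x y) - form z (u (br x y))) = 0.
Proof.
rewrite !hu !ast_br !formE ![form _ (ast _ (u _))]formC.
rewrite !(ast_skew _ (u _)) ![form (u _) (ast _ _)]formC.
by lra.
Qed.

(** This is the a-component of the Jacobi identity for [d], [x], [y]. Eliminating [D (u x)] between
    [Du] and [Du_skew] and antisymmetrising in [x], [y] cancels the symmetric term
    [form (u x) (u y)]. *)
Let skew_D x y :
  form (u x) (D y) - form x (u (D y)) - (form (u y) (D x) - form y (u (D x)))
  = mu * (form (u x) y - form x (u y)) - form b0 (br x y).
Proof.
have := Du_skew (u x) y; have := Du_skew (u y) x.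
have := Du x y; have := Du y x.
rewrite ast_br !formE ?(formC b0) ![form x (u _)]formC ![form y (u _)]formC.
rewrite (formC (u y) (u x)).
by lra.
Qed.

Lemma dext_lie_bracket : lie_bracket gbr.
Proof.
split.
- split=> [[[s x] t] c [[s1 x1] t1] [[s2 x2] t2]|
           [[s x] t] c [[s1 x1] t1] [[s2 x2] t2]];
    rewrite /= ?dextZ ?dextN ?dextD; apply: dext_eq => [|z|];
    rewrite ?skew_partE ?(linE, formE, brE) /GRing.scale /=; ring.
- move=> [[s x] t]; apply: dext_eq => [|z|] //.
  + by rewrite skew_partE (formC x); ring.
  + by rewrite (lie_alternating hbr) !formE; ring.
- move=> [[s x] t] [[s1 x1] t1] [[s2 x2] t2].
  rewrite /= ?dextZ ?dextN ?dextD; apply: dext_eq => [|z|].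
  + have h0 := skew_cocycle x x1 x2.
    have h1 := congr1 ( *%R t) (skew_D x1 x2).
    have h2 := congr1 ( *%R t1) (skew_D x2 x).
    have h3 := congr1 ( *%R t2) (skew_D x x1).
    rewrite !skew_partE ?(linE, formE, brE) /GRing.scale /=.
    by lra.
  + have := congr1 (form^~ z) (lie_jacobi hbr x x1 x2).
    rewrite ?(linE, formE, brE) !hD.
    rewrite ![br (D _) _]brC !formE.
    by lra.
  + by rewrite !addr0.
Qed.

Hypothesis hDast : forall x y,
  ast x (u y) - u (ast x y) = ast (D x) y + ast x (D y) - D (ast x y).

Lemma dext_lc_left_symmetric : left_symmetric dext_lc.
Proof.
move=> [[s x] t] [[s1 x1] t1] [[s2 x2] t2].
rewrite /= ?dextZ ?dextN ?dextD; apply: dext_eq => [|z|].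
- have h0 : form (u (ast x x1)) x2 - form (u (ast x1 x)) x2
      = form (u x) (ast x1 x2) - form (u x1) (ast x x2).
    have := congr1 (form^~ x2) (hu x x1).
    rewrite ast_br linearB /= !formE !(ast_skew _ (u _)).
    rewrite ![form (u _) (ast _ _)]formC.
    by lra.
  have h1 := congr1 ( *%R t) (Du x1 x2).
  have h2 := congr1 ( *%R t1) (Du x x2).
  have h3 := congr1 ( *%R t) (Du_skew (u x1) x2).
  have h4 := congr1 ( *%R t1) (Du_skew (u x) x2).
  move: h3 h4.
  rewrite ?(linE, formE, astE) ?(formC b0) (formC (u x1) (u x)) /GRing.scale /=.
  by lra.
- have h0 := congr1 (form^~ z) (ast_ls x x1 x2).
  (* The weights record which arguments are [d]: [hDast] serves [d] as one of the first two, [hDu]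
     serves [d] there and in the last place, [hu] serves [d] in the last place only. *)
  have h1 := congr1 (fun y => t * form y z) (hDast x1 x2).
  have h2 := congr1 (fun y => t1 * form y z) (hDast x x2).
  have h3 := congr1 (fun y => t * t2 * form y z) (hDu x1).
  have h4 := congr1 (fun y => t1 * t2 * form y z) (hDu x).
  have h5 := congr1 (fun y => t2 * form y z) (hu x x1).
  move: h0 h1 h2 h3 h4 h5.
  rewrite /commutator /rmul ast_br ?(linE, formE, astE) /GRing.scale /=.
  by lra.
- by rewrite /GRing.scale /=; ring.
Qed.
End Bracket.

(** * The commutative associative product and its invariance *)

Section Product.
Hypotheses (hop : bilinear_op op) (opA : associative op) (opC : commutative op).
Hypothesis op_inv : forall x y z, form (op x y) z = form x (op y z).

Let opE := @bilinearE _ _ _ op hop.1 hop.2.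

Hypothesis v_op : forall x y, v (op x y) = op (v x) y.
Hypothesis v_adj : forall x, adjoint form v x = v x.
Hypothesis v_sqr : forall x, v (v x) = lambda *: v x + rmul op a0 x.

Let v_sym x y : form x (v y) = form (v x) y.
Proof. by rewrite -(v_adj y) -adjointP//; apply: linearP. Qed.

Let op_v x y : op x (v y) = v (op x y).
Proof. by rewrite opC -v_op opC. Qed.

Lemma dext_prod_bilinear : bilinear_op gop.
Proof.
split=> [[[s x] t] c [[s1 x1] t1] [[s2 x2] t2]|
         [[s x] t] c [[s1 x1] t1] [[s2 x2] t2]];
  rewrite /= ?dextZ ?dextN ?dextD; apply: dext_eq => [|z|];
  rewrite ?(linE, formE, opE) /GRing.scale /=; ring.
Qed.

Lemma dext_prodC : commutative gop.
Proof.
move=> [[s x] t] [[s1 x1] t1] /=; apply: dext_eq => [|z|].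
- by rewrite (formC (v x)) v_sym; ring.
- by rewrite (opC x) ?formE; ring.
- by ring.
Qed.

Lemma dext_prodA : associative gop.
Proof.
move=> [[s x] t] [[s1 x1] t1] [[s2 x2] t2] /=; apply: dext_eq => [|z|].
(* As [v] is self-adjoint, this is the a-component of [d ** (y ** z) = y ** (d ** z)]; the
   B-component of [(d ** d) ** y = d ** (d ** y)] is [v_sqr] itself. *)
- have h y z : form (v (v y)) z = lambda * form (v y) z + form a0 (op y z).
    by rewrite v_sqr /rmul !formE [op y a0]opC op_inv.
  rewrite ?(linE, formE, opE) (formC (v x) a0) !v_sym v_op op_inv.
  by rewrite !h; lra.
- rewrite ?(linE, formE, opE) !op_v -!v_op !v_sqr /rmul opA (opC a0) !formE.
  by lra.
- by ring.
Qed.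

Lemma dext_prod_invariant p q r : gform (gop p q) r = gform p (gop q r).
Proof.
move: p q r => [[s x] t] [[s1 x1] t1] [[s2 x2] t2] /=.
rewrite ?(linE, formE, opE) op_inv !v_sym (formC (v x) x2) v_sym.
rewrite ![form _ a0]formC (formC (v x2)) v_sym.
by ring.
Qed.

(** * The Leibniz rule *)

Section Leibniz.
Hypotheses (hbr : lie_bracket br).
Hypothesis br_op : forall x y z, br x (op y z) = op (br x y) z + op (br x z) y.
Hypotheses (hlm : lambda * mu = 0) (hDop : derivation op D).
Hypothesis hw_v : forall x,
  u (v x - lambda *: x) - adjoint form u (v x - lambda *: x)
  = ad_tilde br form a0 x + adjoint form D (v x).
Hypothesis v_br : forall x y, v (br x y) = br (v x) y - op (D y) x.
Hypothesis hvD : forall x,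
  - (mu *: v x) + v (D x) + adjoint form D (v x) = - rmul op b0 x.
Hypothesis hb0 : - (mu *: a0) + v b0 = lambda *: b0 - adjoint form D a0.
Hypothesis hDv : forall x, commutator D v x = 0.
Hypothesis hw_a0 :
  u a0 - adjoint form u a0 - 2 *: adjoint form D a0 = - (lambda *: b0).
Hypothesis had_a0 : forall x, ad br a0 x = 2 *: v (D x) - lambda *: D x.
Hypothesis hw_op : forall x y, u (op x y) - adjoint form u (op x y)
  = adjoint form (ad br y) (v x) + adjoint form (ad br x) (v y).
Hypothesis hbeta : - (mu * beta) + form a0 b0 = 0.
Hypothesis hDa0 : D a0 = 0.

Let brE := @bilinearE _ _ _ br (lie_bilinear hbr).1 (lie_bilinear hbr).2.

Let brC x y : br x y = - br y x.
Proof.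
apply/eqP; rewrite -addr_eq0; apply/eqP.
have := lie_alternating hbr (x + y).
by rewrite !brE !(lie_alternating hbr) add0r addr0.
Qed.

Let adj_u x y : form x (adjoint form u y) = form (u x) y.
Proof. by rewrite -adjointP//; apply: linearP. Qed.

Let adj_D x y : form x (adjoint form D y) = form (D x) y.
Proof. by rewrite -adjointP//; apply: linearP. Qed.

Let adj_ad x y z : form x (adjoint form (ad br z) y) = form (br z x) y.
Proof. by rewrite -adjointP//; apply: (lie_bilinear hbr).1. Qed.

(* The name records the types (B or d) of x, y, z in the Leibniz rule for
   [x, y o z], of which the a-component is considered. *)
Let leibniz_BBB x y z : form (u x) (op y z) - form x (u (op y z)) =
  form (v (br x y)) z + form (v (br x z)) y.
Proof.
have := congr1 (form x) (hw_op y z).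
by rewrite !formE !adj_ad adj_u !v_sym (brC z) (brC y) !(linE, formE); lra.
Qed.

Let leibniz_BdB x y : form (u x) (v y) - form x (u (v y)) =
  - form (v (D x)) y + lambda * (form (u x) y - form x (u y))
  + form a0 (br x y).
Proof.
have := congr1 (form x) (hw_v y).
rewrite /ad_tilde !(linE, formE) adj_u adj_D adj_ad (brC y) !(linE, formE).
by rewrite !v_sym [form (br _ _) a0]formC; lra.
Qed.

Let leibniz_Bdd x :
  form (u x) a0 - form x (u a0) = lambda * form b0 x - 2 * form a0 (D x).
Proof.
have := congr1 (form x) hw_a0.
by rewrite !formE adj_u adj_D (formC x b0) (formC a0); lra.
Qed.

Let leibniz_dBB x y : mu * form (v x) y - form b0 (op x y) =
  form (v (D x)) y + form (v (D y)) x.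
Proof.
have := congr1 (form^~ y) (hvD x).
rewrite /rmul !formE (formC (adjoint _ _ _)) adj_D v_sym [op x b0]opC op_inv.
by lra.
Qed.

Let leibniz_ddB x : mu * form a0 x - form b0 (v x) =
  - (lambda * form b0 x) + form a0 (D x).
Proof.
have := congr1 (form x) hb0.
rewrite !formE adj_D v_sym (formC x a0) (formC x b0) (formC (v x)).
by rewrite (formC (D x)); lra.
Qed.

Lemma dext_leibniz p q r : gbr p (gop q r) = gop (gbr p q) r + gop (gbr p r) q.
Proof.
move: p q r => [[s x] t] [[s1 x1] t1] [[s2 x2] t2].
rewrite /= ?dextZ ?dextN ?dextD; apply: dext_eq => [|z|].
- have h1 := leibniz_BBB x x1 x2.
  have h2 := congr1 ( *%R t1) (leibniz_BdB x x2).
  have h3 := congr1 ( *%R t2) (leibniz_BdB x x1).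
  have h4 := congr1 ( *%R (t1 * t2)) (leibniz_Bdd x).
  have h5 := congr1 ( *%R t) (leibniz_dBB x1 x2).
  have h6 := congr1 ( *%R (t * t1)) (leibniz_ddB x2).
  have h7 := congr1 ( *%R (t * t2)) (leibniz_ddB x1).
  (* [hbeta] is the a-component of the rule for [[d, d ** d]]. For [[a, d ** d]] the two sides are
     [- lambda * mu] and [- 2 * lambda * mu] times [a], whence [hlm]. *)
  have h8 := congr1 ( *%R (t * t1 * t2)) hbeta.
  have h9 := congr1 ( *%R (s * t1 * t2)) hlm.
  rewrite !skew_partE ?(linE, formE, opE, brE) /GRing.scale /=.
  rewrite (formC b0 a0).
  by lra.
- have h1 := congr1 (form^~ z) (br_op x x1 x2).
  (* In the B-component, [had_a0] is the rule for [[x, d ** d]], [h3] the one for [[x, d ** y]]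
     (from [v_br] by antisymmetry) and [h4] enters the one for [[d, d ** y]]. *)
  have h2 := congr1 (fun y => t1 * t2 * form y z) (had_a0 x).
  have h3 y : v (br x y) = br x (v y) + op (D x) y.
    by rewrite brC linearN /= v_br (brC (v y)) opprB opprK addrC.
  have h4 y : D (v y) = v (D y) by apply/eqP; rewrite -subr_eq0; apply/eqP/hDv.
  move: h1 h2.
  rewrite ?(linE, formE, opE, brE) ?h3 ?h4 !hDop hDa0 /ad (brC a0).
  rewrite !(opC _ (D _)) ?formE.
  by lra.
- by rewrite /GRing.scale /=; ring.
Qed.
End Leibniz.
End Product.
End DoubleExtension.

(** * Assembly of the axioms *)

Theorem proposition4p7 (R : realType) (B : vectType R)
  (br op : B -> B -> B) (form : B -> B -> R)
  (hB : frobenius_like_poisson br op form)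
  (mu lambda beta : R) (a0 b0 : B) (u D v : {linear B -> B}) :
  let ast := levi_civita br form in
  let adj := adjoint form in
  let uadj := adj u in
  let Dadj := adj D in
  (forall x y, u (br x y) = ast x (u y) - ast y (u x)) ->
  derivation br D ->
  (forall x y, v (op x y) = op (v x) y) ->
  lambda * mu = 0 ->
  (forall x, adj (fun y => D y - u y) x = - (D x - u x)) ->
  (forall x, adj v x = v x) ->
  (forall x, commutator D u x = u (u x) - mu *: u x - rmul ast b0 x) ->
  (forall x y, ast x (u y) - u (ast x y)
             = ast (D x) y + ast x (D y) - D (ast x y)) ->
  (forall x, v (v x) = lambda *: v x + rmul op a0 x) ->
  (forall x, u (v x - lambda *: x) - uadj (v x - lambda *: x)
           = ad_tilde br form a0 x + Dadj (v x)) ->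
  (forall x y, v (br x y) = br (v x) y - op (D y) x) ->
  (forall x, - (mu *: v x) + v (D x) + Dadj (v x) = - rmul op b0 x) ->
  derivation op D ->
  - (mu *: a0) + v b0 = lambda *: b0 - Dadj a0 ->
  (forall x, commutator D v x = 0) ->
  u a0 - uadj a0 - 2 *: Dadj a0 = - (lambda *: b0) ->
  (forall x, ad br a0 x = 2 *: v (D x) - lambda *: D x) ->
  (forall x y, u (op x y) - uadj (op x y)
             = adj (ad br y) (v x) + adj (ad br x) (v y)) ->
  - (mu * beta) + form a0 b0 = 0 ->
  D a0 = 0 ->
  frobenius_like_poisson
    (dext_bracket br form mu b0 u D)
    (dext_prod op form lambda beta a0 v)
    (dext_form form).
Proof.
move=> ast adj uadj Dadj hu hD v_op hlm hskew v_adj hDu hDast v_sqr hw_v v_br.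
move=> hvD hDop hb0 hDv hw_a0 had_a0 hw_op hbeta hDa0.
have hform := flp_scalar_product hB; have hbr := flp_lie hB.
have hop := flp_bilinear hB; have opC := flp_comm hB.
have op_inv := flp_invariant hB.
have hast : is_levi_civita br form ast by apply: levi_civitaP.
have Du_skew x y : form (D x - u x) y = - form x (D y - u y).
  (* The difference is a bare function, so its linearity is an explicit side goal of [adjointP]. *)
  rewrite (@adjointP _ _ _ (fun z => D z - u z) hform) => [|c z1 z2].
    by rewrite -/adj hskew (bilinear_formE (sp_bilinear hform)).
  by rewrite (linearP D) (linearP u) scalerBr opprD addrACA.
(* The scalar product and the Lie bracket come first, since uniqueness of the Levi-Civita product
   rests on both. *)
have hgf := dext_scalar_product hform.
have hgbr : lie_bracket (dext_bracket br form mu b0 u D).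
  by apply: (dext_lie_bracket (ast := ast)).
split=> //.
- exact: dext_prod_bilinear.
- by apply: dext_prodA => //; apply: flp_assoc hB.
- exact: dext_prodC.
- by apply: dext_leibniz => //; apply: flp_leibniz hB.
- have hlc := dext_levi_civita (mu := mu) (b0 := b0) hform hast Du_skew.
  rewrite /flat -(levi_civita_unique hgbr hgf hlc).
  by apply: (dext_lc_left_symmetric hform hast) => //; apply: flp_flat hB.
- exact: dext_prod_invariant.
Qed.
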